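(* Let $F$ be an $(n,m)$-function and let $\omega=\sum_{W\in\mathcal{W}_F}W^4$. Then the number of nonvanishing $2$-flats of $F$ is \[|N_{\mathcal{A},2}(F)|=\frac{2^{4n}(2^m-1)-\omega}{3\cdot 2^{n+m+3}}.\] In particular, if $m=1$ (so $F=f$ is a Boolean function), then $|N_{\mathcal{A},2}(f)|=\frac{2^{4n}-\omega}{3\cdot 2^{n+4}}$.
   Context: An $(n,m)$-function is a map $F\colon\mathbb{F}_2^n\to\mathbb{F}_2^m$. A $2$-flat is a set $U+a$ with $U$ a $2$-dimensional linear subspace of $\mathbb{F}_2^n$ and $a\in\mathbb{F}_2^n$; it is nonvanishing for $F$ if $\sum_{x\in U+a}F(x)\neq 0$. $N_{\mathcal{A},2}(F)$ is the set of nonvanishing $2$-flats of $F$. The Walsh transform of a Boolean function $g\colon\mathbb{F}_2^n\to\mathbb{F}_2$ is $W_g(a)=\sum_{x\in\mathbb{F}_2^n}(-1)^{g(x)+\langle x,a\rangle}$ ($\langle\cdot,\cdot\rangle$ the standard dot product), and its Walsh spectrum is the multiset $\{W_g(a):a\in\mathbb{F}_2^n\}$. The Walsh spectrum $\mathcal{W}_F$ of $F$ is the multiset union, over all nonzero $b\in\mathbb{F}_2^m$, of the Walsh spectra of the component functions $f_b(x)=\langle b,F(x)\rangle$; the sum defining $\omega$ is taken with multiplicity. *)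

(* Defs.v *)
From HB Require Import structures.
From mathcomp Require Import all_boot all_order all_algebra.
From mathcomp Require Import finmap multiset.

Set Implicit Arguments.
Unset Strict Implicit.
Unset Printing Implicit Defensive.

Import GRing.Theory.
Local Open Scope mset_scope.
Local Open Scope ring_scope.

(* Needed to quantify over subspaces in a boolean predicate. *)
HB.instance Definition _ (K : finFieldType) (vT : vectType K) :
  isCountable {vspace vT} :=
  CanIsCountable (@VectorInternalTheory.vs2mxK K vT).
HB.instance Definition _ (K : finFieldType) (vT : vectType K) :
  isFinite {vspace vT} :=
  CanIsFinite (@VectorInternalTheory.vs2mxK K vT).

Definition is_2flat (n : nat) (A : {set 'rV['F_2]_n}) : bool :=
  [exists U : {vspace 'rV['F_2]_n}, exists a : 'rV['F_2]_n,
     (\dim U == 2%N) && (A == [set u + a | u in U])].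

(* The codomain is an arbitrary abelian group, so that this applies both to
   maps into 'rV['F_2]_m and to Boolean functions, valued in 'F_2. *)
Definition nonvanishing_2flats (n : nat) (V : zmodType)
    (F : 'rV['F_2]_n -> V) : {set {set 'rV['F_2]_n}} :=
  [set A | is_2flat A && (\sum_(x in A) F x != 0)].

Definition dotp (n : nat) (x y : 'rV['F_2]_n) : 'F_2 :=
  \sum_(i < n) x 0 i * y 0 i.

(* The exponent is read in nat through the coercion from 'F_2, whose two
   elements have values 0 and 1. *)
Definition walsh (n : nat) (g : 'rV['F_2]_n -> 'F_2) (a : 'rV['F_2]_n) : int :=
  \sum_(x : 'rV['F_2]_n) (-1) ^+ (g x + dotp x a)%R.

Definition walsh_spectrum (n : nat) (g : 'rV['F_2]_n -> 'F_2) : {mset int} :=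
  seq_mset [seq walsh g a | a : 'rV['F_2]_n].

Definition component (n m : nat) (F : 'rV['F_2]_n -> 'rV['F_2]_m)
    (b : 'rV['F_2]_m) : 'rV['F_2]_n -> 'F_2 :=
  fun x => dotp b (F x).

(* msetD adds multiplicities, whereas msetU would take their maximum. *)
Definition vectorial_walsh_spectrum (n m : nat)
    (F : 'rV['F_2]_n -> 'rV['F_2]_m) : {mset int} :=
  \big[msetD/mset0]_(b : 'rV['F_2]_m | b != 0) walsh_spectrum (component F b).

(* A multiset coerces to a sequence listing its elements with multiplicity. *)
Definition fourth_moment (S : {mset int}) : int := \sum_(W <- S) W ^+ 4.

(* Main.v *)
(* Expanding the fourth power and summing over a by orthogonality of characters,
   the fourth moment of the component f_b is 2^n times the sum over (x, y, z) of
   the signs (-1)^<b, F(x) + F(y) + F(z) + F(x + y + z)>.  Orthogonality in b then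
   counts the triples whose flat sum vanishes; those with nonzero flat sum are
   24 to a nonvanishing 2-flat.  The excess term b = 0 contributes 2^(4n). *)

Require Import Defs.
From mathcomp Require Import all_boot all_order all_algebra.
From mathcomp Require Import finfield.
From mathcomp Require Import finmap multiset.
From mathcomp Require Import ring zify.

Import GRing.Theory.
Local Open Scope ring_scope.

(** * Signs, the dot product and orthogonality of characters over ['F_2] *)

Lemma F2P (a : 'F_2) : (a == 0) || (a == 1).
Proof. by case: a => [[|[|//]] ?]. Qed.

Lemma addrr_F2 (a : 'F_2) : a + a = 0.
Proof. by apply/eqP; case/orP: (F2P a) => /eqP->. Qed.

Lemma addrr_rVF2 (n : nat) (v : 'rV['F_2]_n) : v + v = 0.
Proof. by apply/rowP=> i; rewrite !mxE addrr_F2. Qed.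

(** On the left the sum is reduced modulo 2 before it is read as an exponent; a sign depends on
    parity only. *)
Lemma signr_F2D (a b : 'F_2) :
  (-1) ^+ (a + b)%R = (-1) ^+ a * (-1) ^+ b :> int.
Proof. by case/orP: (F2P a) => /eqP->; case/orP: (F2P b) => /eqP->. Qed.

Lemma signr_F2E (a : 'F_2) : (-1) ^+ a = 1 - 2 * (a != 0%R)%:R :> int.
Proof. by case/orP: (F2P a) => /eqP->. Qed.

Lemma dotpC (n : nat) (x y : 'rV['F_2]_n) : dotp x y = dotp y x.
Proof. by apply: eq_bigr => i _; rewrite mulrC. Qed.

Lemma dotpDl (n : nat) (x y z : 'rV['F_2]_n) :
  dotp (x + y) z = dotp x z + dotp y z.
Proof. by rewrite -big_split; apply: eq_bigr => i _; rewrite mxE mulrDl. Qed.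

Lemma dotpDr (n : nat) (x y z : 'rV['F_2]_n) :
  dotp x (y + z) = dotp x y + dotp x z.
Proof. by rewrite !(dotpC _ x) dotpDl. Qed.

Lemma dotp0l (n : nat) (x : 'rV['F_2]_n) : dotp 0 x = 0.
Proof. by rewrite /dotp big1 // => i _; rewrite mxE mul0r. Qed.

Lemma dotp_delta (n : nat) (i : 'I_n) (x : 'rV['F_2]_n) :
  dotp (delta_mx 0 i) x = x 0 i.
Proof.
rewrite /dotp (bigD1 i) //= big1 => [|j ne_ji].
  by rewrite mxE !eqxx mul1r addr0.
by rewrite mxE (negbTE ne_ji) andbF mul0r.
Qed.

Lemma sum_signr_dotp (n : nat) (v : 'rV['F_2]_n) :
  \sum_(b : 'rV['F_2]_n) (-1) ^+ dotp b v = 2 ^+ n * (v == 0%R)%:R :> int.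
Proof.
have [->|/eqP v_neq0] := eqVneq v 0.
  under eq_bigr do rewrite dotpC dotp0l expr0.
  by rewrite sumr_const card_mx card_Fp // mul1n mulr1 natrX.
have /rV0Pn[i vi_neq0] : v != 0 by apply/eqP.
have vi1 : v 0 i = 1.
  by case/orP: (F2P (v 0 i)) vi_neq0 => /eqP-> //; rewrite eqxx.
(* Translating b by the i-th unit vector changes every sign. *)
suff : \sum_(b : 'rV['F_2]_n) (-1) ^+ dotp b v
       = - \sum_(b : 'rV['F_2]_n) (-1) ^+ dotp b v :> int by lia.
rewrite {1}(reindex_inj (addrI (delta_mx 0 i))) -sumrN.
by apply: eq_bigr => b _; rewrite dotpDl dotp_delta vi1 signr_F2D mulN1r.
Qed.

(** For distinct [x], [y], [z] this is the sum of [F] over the unique 2-flat through them. Repeated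
    points are allowed, so that sums may range over all triples. *)
Definition flat_sum {n : nat} {V : zmodType} (F : 'rV['F_2]_n -> V)
  (x y z : 'rV['F_2]_n) : V := F x + F y + F z + F (x + y + z).

(** * Fourth moments of Walsh transforms and of spectra *)

Lemma walsh_expr4 (n : nat) (g : 'rV['F_2]_n -> 'F_2) (a : 'rV['F_2]_n) :
  walsh g a ^+ 4 = \sum_x \sum_y \sum_z \sum_t
    (-1) ^+ (g x + g y + g z + g t)%R * (-1) ^+ dotp a (x + y + z + t).
Proof.
have -> : walsh g a ^+ 4 = walsh g a * (walsh g a * (walsh g a * walsh g a)).
  by ring.
rewrite {1}/walsh mulr_suml; apply: eq_bigr => x _.
rewrite {1}/walsh mulr_suml mulr_sumr; apply: eq_bigr => y _.
rewrite {1}/walsh mulr_suml !mulr_sumr; apply: eq_bigr => z _.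
rewrite {1}/walsh !mulr_sumr; apply: eq_bigr => t _.
by rewrite !dotpDr !signr_F2D !(dotpC _ a); ring.
Qed.

Lemma sum_walsh_expr4 (n : nat) (g : 'rV['F_2]_n -> 'F_2) :
  \sum_a walsh g a ^+ 4
  = 2 ^+ n * \sum_x \sum_y \sum_z (-1) ^+ flat_sum g x y z.
Proof.
under eq_bigr do rewrite walsh_expr4.
rewrite exchange_big mulr_sumr; apply: eq_bigr => x _.
rewrite exchange_big mulr_sumr; apply: eq_bigr => y _.
rewrite exchange_big mulr_sumr; apply: eq_bigr => z _.
rewrite exchange_big /=.
under eq_bigr do rewrite -mulr_sumr sum_signr_dotp.
(* Orthogonality in [a] leaves only the [t] with [x + y + z + t = 0], that is [t = x + y + z]. *)
rewrite (bigD1 (x + y + z)) //= addrr_rVF2 eqxx mulr1 big1 => [|t ne_t].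
  by rewrite addr0 mulrC.
rewrite (_ : (_ == 0) = false) ?mulr0 //; apply: contraNF ne_t => /eqP e.
by rewrite -[t]add0r -e addrAC -addrA addrr_rVF2 addr0.
Qed.

(** Multiplicities add, so listing the sum of two multisets permutes the concatenation of their
    listings. *)
Lemma fourth_momentD (A B : {mset int}%mset) :
  fourth_moment (msetD A B) = fourth_moment A + fourth_moment B.
Proof.
rewrite /fourth_moment -big_cat; apply: perm_big.
by apply/allP=> a _ /=; rewrite count_cat !count_mem_mset msetE2.
Qed.

Lemma fourth_moment_walsh (n : nat) (g : 'rV['F_2]_n -> 'F_2) :
  fourth_moment (walsh_spectrum g) = \sum_a walsh g a ^+ 4.
Proof.
rewrite /fourth_moment (perm_big _ (perm_eq_seq_mset _)) /=.
by rewrite big_map big_enum.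
Qed.

Lemma fourth_moment_vectorial (n m : nat) (F : 'rV['F_2]_n -> 'rV['F_2]_m) :
  fourth_moment (vectorial_walsh_spectrum F)
  = \sum_(b | b != 0) \sum_a walsh (component F b) a ^+ 4.
Proof.
rewrite /vectorial_walsh_spectrum.
rewrite (big_morph _ fourth_momentD (id1 := 0)); last first.
  by rewrite /fourth_moment big_mset0.
by apply: eq_bigr => b _; rewrite fourth_moment_walsh.
Qed.

(** * 2-flats as sets of four points *)

Lemma flat_points_uniq (n : nat) (x y z : 'rV['F_2]_n) :
  uniq [:: x; y; z] -> uniq [:: x + y + z; x; y; z].
Proof.
move=> u; rewrite cons_uniq u andbT !inE; move: u; rewrite /= !inE !negb_or.
case/and3P => /andP[xy xz] yz _.
(* In characteristic 2, if [x + y + z] equals one of the three points, the other two coincide. *)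
apply/and3P; split.
- by rewrite -addrA -[X in _ == X]addr0 (inj_eq (addrI x)) -(addrr_rVF2 _ z)
     (inj_eq (addIr z)).
- by rewrite addrAC -[X in _ == X]add0r (inj_eq (addIr y)) -(addrr_rVF2 _ z)
     (inj_eq (addIr z)).
- by rewrite -[X in _ == X]add0r (inj_eq (addIr z)) -(addrr_rVF2 _ y)
     (inj_eq (addIr y)).
Qed.

Lemma card_flat_points (n : nat) (x y z : 'rV['F_2]_n) :
  uniq [:: x; y; z] -> #|[set v in [:: x + y + z; x; y; z]]| = 4.
Proof. by move=> /flat_points_uniq u; rewrite cardsE; apply/card_uniqP. Qed.

Lemma card_translate (n : nat) (U : {vspace 'rV['F_2]_n}) (a : 'rV['F_2]_n) :
  #|[set u + a | u in U]| = (2 ^ \dim U)%N.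
Proof.
by rewrite card_imset ?card_vspace ?card_Fp //; apply: addIr.
Qed.

Lemma card_2flat (n : nat) (A : {set 'rV['F_2]_n}) : is_2flat A -> #|A| = 4.
Proof.
case/existsP=> U /existsP[a /andP[/eqP dimU /eqP->]].
by rewrite card_translate dimU.
Qed.

Lemma is_2flat_points (n : nat) (x y z : 'rV['F_2]_n) :
  uniq [:: x; y; z] -> is_2flat [set v in [:: x + y + z; x; y; z]].
Proof.
move=> u; have card4 := card_flat_points _ _ _ _ u.
(* Translation by [z] sends the four points to [x + y], [x + z], [y + z] and [0], all in this
   span. *)
pose U := <<[:: (x + z)%R; (y + z)%R]>>%VS.
have dimU : (\dim U <= 2)%N by apply: dim_span.
have xzU : x + z \in U by apply: memv_span; rewrite !inE eqxx.
have yzU : y + z \in U by apply: memv_span; rewrite !inE eqxx orbT.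
have sub : [set v in [:: x + y + z; x; y; z]] \subset [set v + z | v in U].
  apply/subsetP => v; rewrite !inE => v_in; apply/imsetP; exists (v + z).
    case/or4P: v_in => /eqP->; rewrite ?addrr_rVF2 ?mem0v //.
    have -> : x + y + z + z = (x + z) + (y + z) by rewrite [RHS]addrACA addrA.
    by apply: memvD.
  by rewrite -addrA addrr_rVF2 addr0.
have dimU2 : \dim U = 2.
  (* A translate of [U] that contains four points excludes dimensions 0 and 1. *)
  have := subset_leq_card sub; rewrite card4 card_translate.
  by move: (\dim U) dimU => [|[|[|]]].
apply/existsP; exists U; apply/existsP; exists z; rewrite dimU2 /=.
by rewrite eqEcard sub card_translate dimU2 card4.
Qed.

(** A flat is closed under sums of three of its points, since two of the three translation vectors
    cancel; both sets have four elements, so inclusion suffices. *)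
Lemma eq_2flat_points (n : nat) (A : {set 'rV['F_2]_n}) (x y z : 'rV['F_2]_n) :
  is_2flat A -> uniq [:: x; y; z] -> x \in A -> y \in A -> z \in A ->
  A = [set v in [:: x + y + z; x; y; z]].
Proof.
move=> flatA u xA yA zA; apply/esym/eqP.
rewrite eqEcard card_flat_points // card_2flat // andbT.
apply/subsetP => v; rewrite !inE => /or4P[] /eqP-> //.
case/existsP: flatA xA yA zA => U /existsP[a /andP[_ /eqP->]].
case/imsetP=> p pU -> /imsetP[q qU ->] /imsetP[r rU ->].
apply/imsetP; exists (p + q + r); first by rewrite !memvD.
by rewrite (addrACA p) addrr_rVF2 addr0 addrA.
Qed.

Lemma sum_flat_points (n : nat) (V : zmodType) (F : 'rV['F_2]_n -> V)
    (x y z : 'rV['F_2]_n) : uniq [:: x; y; z] ->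
  \sum_(v in [set v in [:: x + y + z; x; y; z]]) F v = flat_sum F x y z.
Proof.
move=> /flat_points_uniq u.
rewrite (eq_bigl (mem [:: x + y + z; x; y; z])) => [|v]; last by rewrite inE.
by rewrite -big_uniq // !big_cons big_nil /= addr0 addrC !addrA.
Qed.

(** * Counting triples with nonzero flat sum *)

Lemma flat_sum_uniq (n : nat) (V : zmodType) (F : 'rV['F_2]_n -> V)
    (x y z : 'rV['F_2]_n) : (forall v : V, v + v = 0) ->
  flat_sum F x y z != 0 -> uniq [:: x; y; z].
Proof.
move=> addVV; apply: contraR; rewrite /= !inE /flat_sum.
(* When two points agree, [x + y + z] is the remaining one, and the four values cancel in pairs. *)
have [->|_] := eqVneq x y.
  by rewrite addrr_rVF2 add0r addVV add0r addVV.
have [->|_] := eqVneq x z.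
  rewrite [z + y + z]addrAC addrr_rVF2 add0r [F z + _ + _]addrAC.
  by rewrite addVV add0r addVV.
have [->|//] := eqVneq y z.
rewrite -[x + z + z]addrA addrr_rVF2 addr0 -[F x + F z + F z]addrA.
by rewrite addVV addr0 addVV.
Qed.

(** Choose [x] in [A], then [y] in [A :\ x], then [z] in [A :\ x :\ y]. Truncated predecessors give
    the correct value 0 when [A] has fewer than three elements. *)
Lemma sum_uniq3 (T : finType) (A : {set T}) :
  (\sum_x \sum_y \sum_z [&& uniq [:: x; y; z], x \in A, y \in A & z \in A]
   = #|A| * (#|A|.-1 * #|A|.-2))%N.
Proof.
rewrite -sum_nat_const [RHS]big_mkcond /=; apply: eq_bigr => x _.
have [xA|xA] := boolP (x \in A); last first.
  by rewrite big1 // => y _; rewrite big1 // => z _; rewrite andbF.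
have -> : #|A|.-1 = #|A :\ x| by rewrite (cardsD1 x A) xA.
rewrite -sum_nat_const [RHS]big_mkcond /=; apply: eq_bigr => y _.
have [yA|yA] := boolP (y \in A :\ x); last first.
  rewrite big1 // => z _; move: yA; rewrite /= !inE; case: eqVneq => [->|_] //=.
  by move=> /negbTE->; rewrite andbF.
have -> : #|A :\ x|.-1 = #|A :\ x :\ y| by rewrite (cardsD1 y (A :\ x)) yA.
rewrite -sum1_card [RHS]big_mkcond /=; apply: eq_bigr => z _.
move: yA; rewrite !inE => /andP[yx ->].
rewrite ![x == _]eq_sym (negbTE yx) /= andbT !(eq_sym z) (eq_sym x z).
by case: (z == x); case: (y == z); case: (z \in A).
Qed.

(* 24 = 4 * 3 * 2 counts the ordered triples of distinct points of a flat, each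
   of which determines the flat; a degenerate triple has zero flat sum. *)
Lemma sum_flat_sum_neq0 (n : nat) (V : zmodType) (F : 'rV['F_2]_n -> V) :
  (forall v : V, v + v = 0) ->
  (\sum_x \sum_y \sum_z (flat_sum F x y z != 0%R)
   = 24 * #|nonvanishing_2flats F|)%N.
Proof.
move=> addVV; rewrite mulnC -sum_nat_const.
(* Double counting of the pairs formed by a nonvanishing flat and an ordered triple of distinct
   points in it. *)
transitivity (\sum_(A in nonvanishing_2flats F) \sum_x \sum_y \sum_z
   [&& uniq [:: x; y; z], x \in A, y \in A & z \in A])%N; last first.
  apply: eq_bigr => A; rewrite inE => /andP[/card_2flat cardA _].
  by rewrite sum_uniq3 cardA.
rewrite [RHS]exchange_big; apply: eq_bigr => x _.
rewrite [RHS]exchange_big; apply: eq_bigr => y _.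
rewrite [RHS]exchange_big; apply: eq_bigr => z _.
have [nz|nz] := boolP (flat_sum F x y z != 0).
  have u := flat_sum_uniq _ _ _ _ _ _ addVV nz.
  (* Exactly one nonvanishing flat contains this triple: the one its points determine. *)
  rewrite (bigD1 [set v in [:: x + y + z; x; y; z]]); last first.
    by rewrite inE is_2flat_points // sum_flat_points.
  rewrite u !inE !eqxx !orbT /= big1 // => A /andP[].
  rewrite inE => /andP[flatA _] neA.
  case: and3P => // -[xA yA zA]; move: neA.
  by rewrite (eq_2flat_points _ _ _ _ _ flatA u xA yA zA) eqxx.
(* A nonvanishing flat containing three distinct points would make their flat sum nonzero. *)
rewrite big1 // => A; rewrite inE => /andP[flatA sumA].
case: (boolP (_ && _)) => // /and4P[u xA yA zA]; move: sumA nz.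
by rewrite (eq_2flat_points _ _ _ _ _ flatA u xA yA zA) sum_flat_points // => ->.
Qed.


(** * Fourth moments in terms of the number of nonvanishing flats *)

Lemma sum_triples (n : nat) :
  \sum_(x : 'rV['F_2]_n) \sum_(y : 'rV['F_2]_n) \sum_(z : 'rV['F_2]_n) 1
  = 2 ^+ (3 * n) :> int.
Proof.
rewrite !sumr_const card_mx card_Fp // mul1n -!mulrnA -[1 *+ _]/(_%:R).
by rewrite -expnD -expnD natrX; congr (_ ^+ _); lia.
Qed.

Lemma sum_flat_sum_eq0 (n : nat) (V : zmodType) (F : 'rV['F_2]_n -> V) :
  (forall v : V, v + v = 0) ->
  \sum_x \sum_y \sum_z (flat_sum F x y z == 0%R)%:R
  = 2 ^+ (3 * n) - 24 * #|nonvanishing_2flats F|%:R :> int.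
Proof.
move=> addVV; rewrite -natrM -sum_flat_sum_neq0 //.
rewrite -sum_triples natr_sum -sumrB; apply: eq_bigr => x _.
rewrite natr_sum -sumrB; apply: eq_bigr => y _.
rewrite natr_sum -sumrB; apply: eq_bigr => z _.
by case: eqP.
Qed.

Lemma fourth_moment_boolean (n : nat) (f : 'rV['F_2]_n -> 'F_2) :
  fourth_moment (walsh_spectrum f)
  = 2 ^+ (4 * n) - 3 * 2 ^+ (n + 4) * #|nonvanishing_2flats f|%:R.
Proof.
rewrite fourth_moment_walsh sum_walsh_expr4.
(* For values in ['F_2] a sign is twice the indicator of zero minus 1, so the sum of signs is twice
   the number of vanishing triples minus the number of all triples. *)
transitivity (2 ^+ n * (2 * (\sum_x \sum_y \sum_z (flat_sum f x y z == 0%R)%:R)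
   - 2 ^+ (3 * n)) : int); last first.
  rewrite sum_flat_sum_eq0; last exact: addrr_F2.
  by rewrite (_ : 4 * n = n + 3 * n)%N ?exprD; [ring | lia].
congr (_ * _).
rewrite -sum_triples mulr_sumr -sumrB; apply: eq_bigr => x _.
rewrite mulr_sumr -sumrB; apply: eq_bigr => y _.
rewrite mulr_sumr -sumrB; apply: eq_bigr => z _.
by rewrite signr_F2E; case: eqP.
Qed.

Lemma flat_sum_component (n m : nat) (F : 'rV['F_2]_n -> 'rV['F_2]_m)
    (b : 'rV['F_2]_m) (x y z : 'rV['F_2]_n) :
  flat_sum (component F b) x y z = dotp b (flat_sum F x y z).
Proof. by rewrite /flat_sum /component !dotpDr. Qed.

Lemma sum_component_walsh_expr4 (n m : nat) (F : 'rV['F_2]_n -> 'rV['F_2]_m) :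
  \sum_b \sum_a walsh (component F b) a ^+ 4
  = 2 ^+ (n + m) * (2 ^+ (3 * n) - 24 * #|nonvanishing_2flats F|%:R).
Proof.
under eq_bigr do rewrite sum_walsh_expr4.
rewrite -mulr_sumr exprD -mulrA -sum_flat_sum_eq0; last exact: addrr_rVF2.
congr (_ * _).
rewrite exchange_big mulr_sumr; apply: eq_bigr => x _.
rewrite exchange_big mulr_sumr; apply: eq_bigr => y _.
rewrite exchange_big mulr_sumr; apply: eq_bigr => z _.
(* Orthogonality in [b] turns the signs of a fixed triple into [2 ^+ m] times the indicator that its
   flat sum vanishes. *)
by under eq_bigr do rewrite flat_sum_component; rewrite sum_signr_dotp.
Qed.

(** The component at [b = 0] is the zero function, whose Walsh transform is [2 ^+ n] at 0 and
    vanishes elsewhere. *)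
Lemma walsh_component0 (n m : nat) (F : 'rV['F_2]_n -> 'rV['F_2]_m) :
  \sum_a walsh (component F 0) a ^+ 4 = 2 ^+ (4 * n).
Proof.
have W a : walsh (component F 0) a = 2 ^+ n * (a == 0%R)%:R.
  rewrite -sum_signr_dotp; apply: eq_bigr => x _.
  by rewrite /component dotp0l add0r.
rewrite (bigD1 0) //= W eqxx mulr1 big1 => [|a /negbTE a0].
  by rewrite addr0 -exprM mulnC.
by rewrite W a0 mulr0 expr0n.
Qed.

Lemma fourth_moment_vectorialE (n m : nat) (F : 'rV['F_2]_n -> 'rV['F_2]_m) :
  fourth_moment (vectorial_walsh_spectrum F)
  = 2 ^+ (4 * n) * (2 ^+ m - 1)
    - 3 * 2 ^+ (n + m + 3) * #|nonvanishing_2flats F|%:R.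
Proof.
rewrite fourth_moment_vectorial.
have := sum_component_walsh_expr4 _ _ F.
(* The sum over all [b] is known; moving its term [b = 0] to the other side yields the sum over
   nonzero [b]. *)
rewrite (bigD1 0) //= walsh_component0 => /(canRL (addKr _)) ->.
by rewrite (_ : 4 * n = n + 3 * n)%N ?exprD; [ring | lia].
Qed.

Theorem theorem3p1 (n m : nat) (F : 'rV['F_2]_n -> 'rV['F_2]_m) :
  let omega : rat := (fourth_moment (vectorial_walsh_spectrum F))%:~R in
  [/\ #|nonvanishing_2flats F|%:R
        = (2 ^+ (4 * n) * (2 ^+ m - 1) - omega) / (3 * 2 ^+ (n + m + 3)) :> rat,
      m = 1%N ->
        #|nonvanishing_2flats F|%:R
          = (2 ^+ (4 * n) - omega) / (3 * 2 ^+ (n + 4)) :> rat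
    & forall f : 'rV['F_2]_n -> 'F_2,
        #|nonvanishing_2flats f|%:R
          = (2 ^+ (4 * n) - (fourth_moment (walsh_spectrum f))%:~R)
              / (3 * 2 ^+ (n + 4)) :> rat].
Proof.
move=> omega.
have denom_neq0 k : 3 * 2 ^+ k != 0 :> rat by rewrite mulf_neq0 ?expf_neq0.
have eqF : #|nonvanishing_2flats F|%:R
        = (2 ^+ (4 * n) * (2 ^+ m - 1) - omega) / (3 * 2 ^+ (n + m + 3)) :> rat.
  apply: (canRL (mulfK (denom_neq0 _))); rewrite /omega fourth_moment_vectorialE.
  by rewrite !(rmorphB, rmorphM, rmorphXn, rmorph_nat) /=; ring.
split=> // [m1|f].
  rewrite eqF; have -> : 2 ^+ m - 1 = 1 :> rat by rewrite m1.
  by rewrite mulr1 m1 -addnA.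
(* A map into ['F_2] is not literally one into row vectors of length 1, so this case rests on the
   scalar formula. *)
apply: (canRL (mulfK (denom_neq0 _))); rewrite fourth_moment_boolean.
by rewrite !(rmorphB, rmorphM, rmorphXn, rmorph_nat) /=; ring.
Qed.
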